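(* Let $d\geq 2$, let $\beta\colon \mathrm{Pol}(O_d^+)\to\mathcal{B}$ be a surjective unital ${}^*$-homomorphism onto a unital ${}^*$-algebra $\mathcal{B}=\mathrm{Pol}(\mathbb{X})$ which admits a faithful ${}^*$-representation on a Hilbert space, and write $\dot u_{ij}=\beta(u_{ij})$. Let $(\mathcal{A},\varphi)$ be a non-commutative probability space and let $X_1,\dots,X_d\in\mathcal{A}$ be self-adjoint, freely independent and identically distributed. Put $Y_j=\sum_{i=1}^d X_i\otimes\dot u_{ij}\in\mathcal{A}\otimes\mathcal{B}$ for $j=1,\dots,d$. Suppose that $Y_1,\dots,Y_d$ are free with amalgamation over $\mathcal{B}$ in the $\mathcal{B}$-valued probability space $(\mathcal{A}\otimes\mathcal{B},\mathcal{B},E)$, $E=\varphi\otimes\mathrm{id}$. Then either $\mathbb{X}\subset H_d^+$ (i.e. $\dot u_{ij}^2=\dot u_{ij}^4$ for all $i,j$, equivalently $\beta$ factors through $\mathrm{Pol}(H_d^+)$), or $X_1,\dots,X_d$ are semicircular, i.e. $\kappa_n(X_i)=0$ for all $n\geq 3$ and all $i$.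
   Context: $\mathrm{Pol}(O_d^+)$ is the universal unital ${}^*$-algebra generated by $d^2$ self-adjoint elements $u_{ij}$ ($1\le i,j\le d$) such that the matrix $u=(u_{ij})$ satisfies $u^\top u=uu^\top=\mathbb{1}$, i.e. $\sum_i u_{ij}^2=\mathbb 1=\sum_j u_{ij}^2$ and $\sum_i u_{ij}u_{ij'}=0=\sum_j u_{ij}u_{i'j}$ for $i\ne i'$, $j\neq j'$. $\mathrm{Pol}(H_d^+)$ is the quotient of $\mathrm{Pol}(O_d^+)$ by the ideal generated by $u_{ij}u_{ij'}$ and $u_{ji}u_{j'i}$ for all $i$ and $j\ne j'$ (in a C*-setting equivalent to adding $u_{ij}^3=u_{ij}$). A non-commutative probability space $(\mathcal{A},\varphi)$ is a unital ${}^*$-algebra with a unital positive linear functional. For a ${}^*$-subalgebra $\mathcal B\subset\mathcal C$ and a conditional expectation $E\colon\mathcal C\to\mathcal B$ ($E(b)=b$, $E(b_1ab_2)=b_1E(a)b_2$), subalgebras $\mathcal C_k\supset\mathcal B$ are free with amalgamation over $\mathcal B$ if $E(a_1\cdots a_n)=0$ whenever $a_r\in\mathcal C_{k_r}$, $k_1\ne k_2\ne\dots\ne k_n$, $E(a_r)=0$; elements are free with amalgamation if the algebras they generate together with $\mathcal B$ are. Here $\mathcal B$ is identified with $\mathbb 1\otimes\mathcal B$. $\kappa_n$ denotes the scalar free cumulants of $(\mathcal A,\varphi)$, defined by $\varphi(a_1\cdots a_m)=\sum_{\pi\in NC(m)}\prod_{B\in\pi}\kappa_{|B|}(a_i:i\in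 B)$, and $\kappa_n(X)=\kappa_n(X,\dots,X)$. *)

(* Defs.v *)
(* Scalars: an arbitrary numClosedFieldType C (stands for the complex numbers). *)
From HB Require Import structures.
From mathcomp Require Import all_boot all_order all_algebra.
Set Implicit Arguments. Unset Strict Implicit. Unset Printing Implicit Defensive.
Import Order.TTheory GRing.Theory Num.Theory.
Local Open Scope ring_scope.

(* s is an involution making the unital C-algebra A a *-algebra *)
Definition is_star (C : numClosedFieldType) (A : algType C) (s : A -> A) : Prop :=
  (forall x, s (s x) = x) /\
  (forall x y, s (x + y) = s x + s y) /\
  (forall x y, s (x * y) = s y * s x) /\
  (forall (c : C) x, s (c *: x) = c^* *: s x).

(* phi is a unital positive linear functional on the *-algebra (A, s) *)
Definition is_state (C : numClosedFieldType) (A : algType C) (s : A -> A)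
  (phi : A -> C) : Prop :=
  (forall (c : C) x y, phi (c *: x + y) = c * phi x + phi y) /\
  phi 1 = 1 /\
  (forall x, 0 <= phi (s x * x)).

(* x lies in the unital subalgebra of A generated by the set G *)
Definition in_gen_alg (C : numClosedFieldType) (A : algType C) (G : A -> Prop)
  (x : A) : Prop :=
  forall S : A -> Prop,
    S 1 -> (forall g, G g -> S g) ->
    (forall y z, S y -> S z -> S (y + z)) ->
    (forall y z, S y -> S z -> S (y * z)) ->
    (forall (c : C) y, S y -> S (c *: y)) -> S x.

(* the d x d matrix ud of self-adjoint elements satisfies the defining
   relations of Pol(O_d^+):  ud^T ud = ud ud^T = 1 *)
Definition OdPlus_rel (C : numClosedFieldType) (B : algType C) (s : B -> B)
  (d : nat) (ud : 'I_d -> 'I_d -> B) : Prop :=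
  (forall i j, s (ud i j) = ud i j) /\
  (forall i j, \sum_(k < d) ud k i * ud k j = (i == j)%:R) /\
  (forall i j, \sum_(k < d) ud i k * ud j k = (i == j)%:R).

(* B admits a faithful *-representation by (adjointable) operators on an
   inner-product space over C *)
Definition has_faithful_star_rep (C : numClosedFieldType) (B : algType C)
  (s : B -> B) : Prop :=
  exists (V : lmodType C) (ip : V -> V -> C) (pi : B -> V -> V),
    (forall x y z (c : C), ip x (c *: y + z) = c * ip x y + ip x z) /\
    (forall x y, ip y x = (ip x y)^*) /\
    (forall x, x != 0 -> 0 < ip x x) /\
    (forall b (c : C) x y, pi b (c *: x + y) = c *: pi b x + pi b y) /\
    (forall x, pi 1 x = x) /\
    (forall b b' x, pi (b + b') x = pi b x + pi b' x) /\
    (forall (c : C) b x, pi (c *: b) x = c *: pi b x) /\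
    (forall b b' x, pi (b * b') x = pi b (pi b' x)) /\
    (forall b x y, ip (pi b x) y = ip x (pi (s b) y)) /\
    (forall b, (forall x, pi b x = 0) -> b = 0).

(* scalar freeness of X_1..X_d in (A, phi): for n >= 1, alternating indices,
   a_r in the unital algebra generated by X_{k_r}, phi(a_r) = 0 *)
Definition free_family (C : numClosedFieldType) (A : algType C) (phi : A -> C)
  (d : nat) (X : 'I_d -> A) : Prop :=
  forall s : seq ('I_d * A),
    (0 < size s)%N ->
    sorted (fun i j : 'I_d => i != j) (map fst s) ->
    (forall p, p \in s -> in_gen_alg (fun y => y = X p.1) p.2 /\ phi p.2 = 0) ->
    phi (\prod_(p <- s) p.2) = 0.

(* Algebraic tensor product A (x) B: an element is represented by a finite
   formal sum  \sum a_k (x) b_k, i.e. a list of pairs (a_k, b_k). *)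
Definition tmul (C : numClosedFieldType) (A B : algType C)
  (l m : seq (A * B)) : seq (A * B) :=
  [seq (p.1 * q.1, p.2 * q.2) | p <- l, q <- m].

Definition tscale (C : numClosedFieldType) (A B : algType C) (c : C)
  (l : seq (A * B)) : seq (A * B) := [seq (c *: p.1, p.2) | p <- l].

(* E = phi (x) id *)
Definition tE (C : numClosedFieldType) (A B : algType C) (phi : A -> C)
  (l : seq (A * B)) : B := \sum_(p <- l) phi p.1 *: p.2.

(* l represents an element of the unital subalgebra of A (x) B generated by
   1 (x) B together with the tensor represented by g *)
Definition in_gen_Balg (C : numClosedFieldType) (A B : algType C)
  (g : seq (A * B)) (l : seq (A * B)) : Prop :=
  forall S : seq (A * B) -> Prop,
    (forall b : B, S [:: (1, b)]) -> S g ->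
    (forall l1 l2, S l1 -> S l2 -> S (l1 ++ l2)) ->
    (forall l1 l2, S l1 -> S l2 -> S (tmul l1 l2)) ->
    (forall (c : C) l1, S l1 -> S (tscale c l1)) -> S l.

(* Y_j = \sum_i X_i (x) ud_ij *)
Definition Ytens (C : numClosedFieldType) (A B : algType C) (d : nat)
  (X : 'I_d -> A) (ud : 'I_d -> 'I_d -> B) (j : 'I_d) : seq (A * B) :=
  [seq (X i, ud i j) | i <- enum 'I_d].

(* Y_1..Y_d are free with amalgamation over B w.r.t. E = phi (x) id *)
Definition amalg_free (C : numClosedFieldType) (A B : algType C) (phi : A -> C)
  (d : nat) (Y : 'I_d -> seq (A * B)) : Prop :=
  forall s : seq ('I_d * seq (A * B)),
    (0 < size s)%N ->
    sorted (fun i j : 'I_d => i != j) (map fst s) ->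
    (forall p, p \in s -> in_gen_Balg (Y p.1) p.2 /\ tE phi p.2 = 0) ->
    tE phi (foldr (@tmul C A B) [:: (1, 1)] (map snd s)) = 0.

(* noncrossing partitions of {0,..,m-1} *)
Definition noncrossing (m : nat) (P : {set {set 'I_m}}) : bool :=
  [forall B1 in P, forall B2 in P, (B1 != B2) ==>
    ~~ [exists a : 'I_m, exists b : 'I_m, exists c : 'I_m, exists e : 'I_m,
         ((a < b)%N && (b < c)%N && (c < e)%N) &&
         ((a \in B1) && (c \in B1) && (b \in B2) && (e \in B2))]].

Definition NC (m : nat) : {set {set {set 'I_m}}} :=
  [set P : {set {set 'I_m}} | partition P [set: 'I_m] && noncrossing P].

(* kseq mom n = [:: 0; kappa_1; ...; kappa_n], solving the moment-cumulant
   formula  mom m = \sum_{P in NC(m)} \prod_{B in P} kappa_|B|  recursively *)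
Fixpoint kseq (C : numClosedFieldType) (mom : nat -> C) (n : nat) : seq C :=
  match n with
  | 0 => [:: 0]
  | n'.+1 =>
      let s := kseq mom n' in
      rcons s (mom n'.+1 -
        \sum_(P in NC n'.+1 | P != [set [set: 'I_n'.+1]])
           \prod_(Bk in P) s`_#|Bk|)
  end.

(* the n-th free cumulant of a variable with moment sequence mom *)
Definition free_cumulant (C : numClosedFieldType) (mom : nat -> C) (n : nat) : C :=
  (kseq mom n)`_n.

(* Main.v *)
(* Suppose that kappa_n is the first nonzero free cumulant of order n >= 3, and
   center the variables: X'_i = X_i - kappa_1. Freeness determines mixed moments
   from the individual ones, so up to order n - 1, and on nonconstant words of
   length n, the moments of the X'_i are those s(w) of the free semicircular
   family on the full Fock space; on constant words of length n they are
   s(w) + kappa_n. The functional s is invariant under the transformation by u,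
   so E(Y'_j^k) is the scalar s(j^k) for k < n, and freeness with amalgamation
   gives E(Y'_{j_1} ... Y'_{j_n}) = s(j) for nonconstant j. Expanding the left
   side yields s(j) + kappa_n \sum_i u_{i j_1} ... u_{i j_n} instead, so this sum
   vanishes. Orthogonality of the rows contracts the first index and then the
   last ones away, leaving u_{kj} u_{kj'} = 0 for j <> j', hence u_{kj}^2 = u_{kj}^4.
   Cumulants enter only through noncrossing partitions with blocks of size at
   most 2, whose sum satisfies the first-block recursion of the Fock moments. *)
Require Import Defs.
From HB Require Import structures.
From mathcomp Require Import all_boot all_order all_algebra zify ring.
Set Implicit Arguments. Unset Strict Implicit. Unset Printing Implicit Defensive.
Import Order.TTheory GRing.Theory Num.Theory.
Local Open Scope ring_scope.

(** * Weighted sums over noncrossing partitions of finite sets of positions *)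

Section NoncrossingSums.

Variables (R : comNzRingType) (n : nat).
Implicit Types (f : nat -> R) (S A B : {set 'I_n}) (P : {set {set 'I_n}}).

Lemma noncrossingP P :
  reflect (forall A B, A \in P -> B \in P -> A != B ->
             forall a b c e : 'I_n, (a < b)%N -> (b < c)%N -> (c < e)%N ->
             a \in A -> c \in A -> b \in B -> e \in B -> False)
          (noncrossing P).
Proof.
apply: (iffP idP) => [ncP A B AP BP neAB a b c e ab bc ce aA cA bB eB | ncP].
  move/forall_inP/(_ A AP)/forall_inP/(_ B BP)/implyP/(_ neAB)/negP: ncP; apply.
  apply/existsP; exists a; apply/existsP; exists b.
  apply/existsP; exists c; apply/existsP; exists e.
  by rewrite ab bc ce aA cA bB eB.
apply/forall_inP => A AP; apply/forall_inP => B BP; apply/implyP => neAB.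
apply/negP => /existsP[a /existsP[b /existsP[c /existsP[e]]]].
case/andP=> /andP[/andP[ab bc] ce] /andP[/andP[/andP[aA cA] bB] eB].
exact: (ncP A B AP BP neAB a b c e).
Qed.

Lemma noncrossingS P (Q : {set {set 'I_n}}) :
  P \subset Q -> noncrossing Q -> noncrossing P.
Proof.
move=> /subsetP sPQ /noncrossingP ncQ; apply/noncrossingP => A B /sPQ AQ /sPQ BQ.
exact: ncQ.
Qed.

(** The ground set is any set of positions, so that deleting a block or cutting at a point yields a
    sum of the same form. *)
Definition nc_sum f S : R :=
  \sum_(P | partition P S && noncrossing P) \prod_(B in P) f #|B|.

Lemma nc_sum0 f : nc_sum f set0 = 1.
Proof.
rewrite /nc_sum (big_pred1 set0) ?big_set0 // => P /=.
rewrite partition_set0; case: eqP => //= ->.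
by apply/noncrossingP => A B; rewrite inE.
Qed.

(** Deleting [B] is a bijection onto the partitions of [S :\: B]; the condition stays on [B |: P]
    because [B] may still cross blocks of [P]. *)
Lemma nc_sum_block f S B x : x \in B -> B \subset S ->
  \sum_(P | (partition P S && noncrossing P) && (pblock P x == B))
     \prod_(A in P) f #|A| =
  f #|B| * \sum_(P | partition P (S :\: B) && noncrossing (B |: P))
     \prod_(A in P) f #|A|.
Proof.
move=> xB sBS; have B0 : B != set0 by apply/set0Pn; exists x.
have memB P : partition P S -> pblock P x == B -> B \in P.
  move=> partP /eqP <-; apply: pblock_mem.
  by rewrite (cover_partition partP) (subsetP sBS).
rewrite (reindex_onto (fun P => B |: P) (fun P => P :\ B)) /=; last first.
  by move=> P /andP[/andP[partP _] pxB]; rewrite setD1K // memB.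
have notinB P : partition P (S :\: B) -> B \notin P.
  move=> partP; apply/negP => /(partitionS partP)/subsetP/(_ x xB).
  by rewrite inE xB.
rewrite mulr_sumr; apply: eq_big => [P | P].
  apply/idP/idP => [/andP[/andP[/andP[partBP ncBP] _] /eqP <-] | /andP[partP ncBP]].
    by rewrite partitionD1 ?setU11 // setD1K ?setU11.
  have BnP := notinB _ partP.
  have partBP : partition (B |: P) S.
    rewrite -(setID S B) (setIidPr sBS); apply: partitionU1 => //.
    by rewrite -setI_eq0; apply/eqP/setP => z; rewrite !inE; case: (z \in B).
  by rewrite partBP ncBP setU1K // (def_pblock _ (setU11 _ _) xB)
    ?(partition_trivIset partBP) ?eqxx.
case/andP=> /andP[/andP[partBP _] _] /eqP BPK.
by rewrite big_setU1 //= -BPK setD11.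
Qed.

(** Blocks in two separated sets never cross, so such a partition is an arbitrary pair of
    noncrossing partitions of the two sides. *)
Lemma nc_sum_split f (S1 S2 : {set 'I_n}) :
  (forall x y : 'I_n, x \in S1 -> y \in S2 -> (x < y)%N) ->
  \sum_(P | partition P (S1 :|: S2) &&
            ([forall A in P, (A \subset S1) || (A \subset S2)] && noncrossing P))
     \prod_(A in P) f #|A| = nc_sum f S1 * nc_sum f S2.
Proof.
move=> lt12; have dis12 x : x \in S1 -> x \in S2 -> False.
  by move=> x1 x2; have := lt12 x x x1 x2; rewrite ltnn.
rewrite /nc_sum big_distrlr pair_big /=.
rewrite (reindex_onto (fun p => p.1 :|: p.2) (fun P => (P ::&: S1, P ::&: S2))) /=;
  last first.
  move=> P /andP[_ /andP[/forall_inP sub _]].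
  apply/setP => A; rewrite !inE -andb_orr; case AP: (A \in P) => //=.
  exact: sub.
apply: eq_big => [[p1 p2] | [p1 p2]] /=; last first.
  case/andP=> /andP[partP _] /eqP[e1 e2].
  rewrite -bigU; last first.
    rewrite -setI_eq0; apply/eqP/setP => A; rewrite !inE.
    apply/negP => /andP[A1 A2].
    have sA1 : A \subset S1 by move: A1; rewrite -e1 inE => /andP[].
    have sA2 : A \subset S2 by move: A2; rewrite -e2 inE => /andP[].
    move: (partition_neq0 partP (B := A)); rewrite inE A1 => /(_ isT).
    by case/set0Pn => x xA; apply: (dis12 x); [apply: (subsetP sA1)|apply: (subsetP sA2)].
  by apply: eq_bigl => A; rewrite !inE.
apply/idP/idP.
  case/andP=> /andP[partP /andP[_ ncP]] /eqP[e1 e2].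
  have covP := cover_partition partP.
  (* One argument serves both sides: a block outside [p] lies in [S'], so the blocks of [p] must
     cover [S]. *)
  have part_r S (S' : {set 'I_n}) (p : {set {set 'I_n}}) : p \subset p1 :|: p2 ->
      S :|: S' = S1 :|: S2 ->
      (forall A, A \in p1 :|: p2 -> A \in p \/ A \subset S') ->
      (forall A, A \in p -> A \subset S) ->
      (forall x, x \in S -> x \in S' -> False) -> partition p S.
    move=> sp eS memp subS disS; apply/and3P; split.
    - apply/eqP/setP => x; apply/bigcupP/idP => [[A Ap] | xS].
        exact/subsetP/subS.
      have : x \in cover (p1 :|: p2) by rewrite covP -eS inE xS.
      case/bigcupP => A AP xA; case: (memp A AP) => [Ap | sA]; first by exists A.
      by case: (disS x xS); apply: (subsetP sA).
    - exact: trivIsetS sp (partition_trivIset partP).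
    - by apply/negP => /(subsetP sp); rewrite (partition0 partP).
  have s1 A : A \in p1 -> A \subset S1 by rewrite -e1 inE => /andP[].
  have s2 A : A \in p2 -> A \subset S2 by rewrite -e2 inE => /andP[].
  apply/andP; split; apply/andP; split.
  - apply: (part_r _ S2) => //; first exact: subsetUl.
    by move=> A; rewrite inE => /orP[]; [left | right; apply: s2].
  - exact: noncrossingS (subsetUl _ _) ncP.
  - apply: (part_r _ S1) => //; [exact: subsetUr | exact: setUC | |].
      by move=> A; rewrite inE => /orP[]; [right; apply: s1 | left].
    by move=> x x2 x1; apply: (dis12 x).
  - exact: noncrossingS (subsetUr _ _) ncP.
case/andP=> /andP[part1 nc1] /andP[part2 nc2].
have s1 A : A \in p1 -> A \subset S1 by apply: partitionS.
have s2 A : A \in p2 -> A \subset S2 by apply: partitionS.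
have no12 A : A != set0 -> A \subset S1 -> A \subset S2 -> False.
  case/set0Pn=> x xA /subsetP/(_ x xA) x1 /subsetP/(_ x xA); exact: dis12.
have e1 : (p1 :|: p2) ::&: S1 = p1.
  apply/setP => A; rewrite !inE; case A1: (A \in p1) => /=; first exact: s1.
  apply/negP => /andP[A2 sA]; apply: (no12 A) => //; last exact: s2.
  exact: partition_neq0 part2 A2.
have e2 : (p1 :|: p2) ::&: S2 = p2.
  apply/setP => A; rewrite !inE; case A2: (A \in p2); rewrite ?orbT ?orbF /=.
    exact: s2.
  apply/negP => /andP[A1 sA]; apply: (no12 A) => //; last exact: s1.
  exact: partition_neq0 part1 A1.
rewrite e1 e2 eqxx andbT; apply/andP; split.
  apply/and3P; split.
  - by rewrite /cover bigcup_setU -!/(cover _) (cover_partition part1)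
      (cover_partition part2).
  - apply: trivIsetU; [exact: partition_trivIset part1 | |].
      exact: partition_trivIset part2.
    rewrite (cover_partition part1) (cover_partition part2) -setI_eq0.
    apply/eqP/setP => x; rewrite !inE; apply/negP => /andP[]; exact: dis12.
  - by rewrite inE (partition0 part1) (partition0 part2).
apply/andP; split.
  by apply/forall_inP => A; rewrite inE => /orP[/s1 -> | /s2 ->] //; rewrite orbT.
apply/noncrossingP => A B; rewrite !inE => /orP[AP | AP] /orP[BP | BP] neAB.
all: move=> a b c e ab bc ce aA cA bB eB.
- exact: (noncrossingP _ nc1 A B AP BP neAB a b c e).
- have := lt12 c b (subsetP (s1 _ AP) _ cA) (subsetP (s2 _ BP) _ bB).
  by rewrite ltnNge ltnW.
- have := lt12 b a (subsetP (s1 _ BP) _ bB) (subsetP (s2 _ AP) _ aA).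
  by rewrite ltnNge ltnW.
- exact: (noncrossingP _ nc2 A B AP BP neAB a b c e).
Qed.

Lemma noncrossing_set1U P x : noncrossing ([set x] |: P) = noncrossing P.
Proof.
apply/idP/idP => [|/noncrossingP ncP]; first by apply: noncrossingS; apply: subsetUr.
apply/noncrossingP => A B /setU1P[-> | AP] /setU1P[-> | BP] neAB a b c e ab bc ce.
- by rewrite eqxx in neAB.
- by rewrite !inE => /eqP ea /eqP ec; have := ltn_trans ab bc; rewrite ea ec ltnn.
- by rewrite !inE => _ _ /eqP eb /eqP ee; have := ltn_trans bc ce; rewrite eb ee ltnn.
- exact: (ncP A B AP BP neAB a b c e).
Qed.

(** As [x] precedes [S], a block with points [t < y < z] crosses the pair through [x < t < y < z],
    and no other crossing with the pair is possible. *)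
Lemma noncrossing_set2U P S x y : x \notin S -> y \notin S -> (x < y)%N ->
  (forall z, z \in S -> (x < z)%N) -> partition P S ->
  noncrossing ([set x; y] |: P) =
  [forall A in P, (A \subset [set z in S | (z < y)%N]) ||
                  (A \subset [set z in S | (y < z)%N])] && noncrossing P.
Proof.
move=> xS yS xy minS partP.
have sPS A z : A \in P -> z \in A -> z \in S.
  by move/(partitionS partP)/subsetP; apply.
have ney z : z \in S -> (z != y :> nat) by apply: contraTneq => /val_inj ->.
have nexA A z : A \in P -> z \in [set x; y] -> z \in A -> False.
  by move=> AP /set2P[] -> /(sPS _ _ AP); apply/negP.
apply/idP/andP => [ncP | [/forall_inP sub /noncrossingP ncP]].
  split; last by apply: noncrossingS ncP; apply: subsetUr.
  apply/forall_inP => A AP; rewrite -[_ || _]negbK negb_or.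
  apply/negP => /andP[/subsetPn[z zA]]; rewrite inE (sPS _ _ AP zA) -leqNgt /= => yz.
  case/subsetPn=> t tA; rewrite inE (sPS _ _ AP tA) -leqNgt /= => ty.
  have tS := sPS _ _ AP tA; have zS := sPS _ _ AP zA.
  have neA : [set x; y] != A.
    by apply/eqP => eA; apply: (nexA A x AP); rewrite -?eA set21.
  apply: (noncrossingP _ ncP [set x; y] A (setU11 _ _) (setU1r _ AP) neA x t y z);
    rewrite ?set21 ?set22 ?minS //.
    by rewrite ltn_neqAle ney.
  by rewrite ltn_neqAle eq_sym ney.
apply/noncrossingP => A B /setU1P[-> | AP] /setU1P[-> | BP] neAB.
all: move=> a b c e ab bc ce aA cA bB eB.
- by rewrite eqxx in neAB.
- have [bS eS] := (sPS _ _ BP bB, sPS _ _ BP eB).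
  have ac := ltn_trans ab bc; have [_ ec] : a = x /\ c = y.
    by case/set2P: aA => ea; case/set2P: cA => ec; split=> //; exfalso;
      move: ac; rewrite ea ec; lia.
  rewrite ec in bc ce.
  by case/orP: (sub B BP) => /subsetP sB; [move: (sB e eB) | move: (sB b bB)];
    rewrite inE => /andP[_]; lia.
- have [aS cS] := (sPS _ _ AP aA, sPS _ _ AP cA).
  have := minS _ aS; have := minS _ cS.
  case/set2P: bB ab bc => ->; case/set2P: eB ce => -> //=; lia.
- exact: (ncP A B AP BP neAB a b c e).
Qed.

(** Partitions are sorted by the block of the least point: a singleton, or a pair [[set x; y]]
    separating the points before [y] from those after it; larger blocks have weight 0. *)
Lemma nc_sum_min f S x : (forall k, (2 < k)%N -> f k = 0) ->
  x \in S -> (forall z, z \in S :\ x -> (x < z)%N) ->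
  nc_sum f S = f 1%N * nc_sum f (S :\ x) +
    f 2%N * \sum_(y in S :\ x) nc_sum f [set z in S :\ x | (z < y)%N] *
                               nc_sum f [set z in S :\ x | (y < z)%N].
Proof.
move=> f0 xS minx; rewrite {1}/nc_sum.
rewrite (partition_big (fun P => pblock P x) (fun B => (x \in B) && (B \subset S))) /=;
  last first.
  move=> P /andP[partP _]; have covP := cover_partition partP.
  rewrite mem_pblock covP xS /=; apply: partitionS partP _.
  by apply: pblock_mem; rewrite covP.
under eq_bigr => B /andP[xB sBS] do rewrite nc_sum_block //.
rewrite (bigD1 [set x]) /=; last by rewrite set11 sub1set.
rewrite cards1; congr (_ * _ + _).
  by apply: eq_bigl => P; rewrite noncrossing_set1U.
have injx : {in S :\ x &, injective (fun y => [set x; y])}.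
  move=> y z; rewrite !inE => /andP[yx _] _ /setP/(_ y).
  by rewrite !inE eqxx orbT (negPf yx) /= => /esym/eqP.
rewrite mulr_sumr (bigID (fun B => #|B| == 2%N)) /= [X in _ + X]big1 ?addr0;
  last first.
  move=> B /andP[/andP[/andP[xB sBS] neB] cB]; rewrite f0 ?mul0r //.
  rewrite ltn_neqAle eq_sym cB /=.
  by rewrite (cardsD1 x) xB ltnS lt0n cards_eq0 setD_eq0 subset1 (negPf neB) /=;
    apply/set0Pn; exists x.
transitivity (\sum_(y in S :\ x) f 2%N *
  \sum_(P | partition P (S :\: [set x; y]) && noncrossing ([set x; y] |: P))
     \prod_(A in P) f #|A|).
  rewrite -(big_imset (fun B => f 2%N * \sum_(P | partition P (S :\: B) &&
      noncrossing (B |: P)) \prod_(A in P) f #|A|) injx) /=.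
  apply: eq_big => [B | B /andP[_ /eqP ->]] //.
  apply/idP/imsetP => [/andP[/andP[/andP[xB sBS] _] cB] | [y]].
    have /cards1P[y eBx] : #|B :\ x| == 1%N by move: cB; rewrite (cardsD1 x B) xB.
    have yBx : y \in B :\ x by rewrite eBx set11.
    exists y; last by rewrite -(setD1K xB) eBx.
    by move: yBx; rewrite !inE => /andP[-> /(subsetP sBS)].
  rewrite !inE => /andP[yx yS] ->.
  rewrite set21 cards2 (eq_sym x y) yx /= andbT; apply/andP; split.
    by apply/subsetP => z /set2P[] ->.
  by apply/eqP => /setP/(_ y); rewrite !inE eqxx orbT (negPf yx).
apply: eq_bigr => y yS; congr (_ * _); move: (yS); rewrite !inE => /andP[yx yS'].
have minx' z : z \in S :\: [set x; y] -> (x < z)%N.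
  by move=> zS; apply: minx; move: zS; rewrite !inE negb_or => /andP[/andP[-> _] ->].
rewrite -nc_sum_split; last first.
  by move=> z t; rewrite !inE => /andP[_ zy] /andP[_ yt]; apply: ltn_trans zy yt.
have eS : [set z in S :\ x | (z < y)%N] :|: [set z in S :\ x | (y < z)%N] =
          S :\: [set x; y].
  apply/setP => z; rewrite !inE -andb_orr negb_or -neq_ltn andbAC; congr (_ && _).
rewrite eS; apply: eq_bigl => P; case partP: (partition P _) => //=.
rewrite (noncrossing_set2U _ _ (minx _ yS) minx' partP) ?inE ?eqxx ?orbT //.
have e1 : [set z in S :\: [set x; y] | (z < y)%N] = [set z in S :\ x | (z < y)%N].
  by apply/setP => z; rewrite -eS !inE; case: ltngtP; rewrite ?andbF ?orbF ?andbT.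
have e2 : [set z in S :\: [set x; y] | (y < z)%N] = [set z in S :\ x | (y < z)%N].
  by apply/setP => z; rewrite -eS !inE; case: ltngtP; rewrite ?andbF ?orbF ?andbT.
by rewrite e1 e2.
Qed.

(** The rank of [y] in [S] takes each value below [#|S|] once; removing the maximum gives the
    induction. *)
Lemma sum_card_lt (T : nmodType) (g : nat -> T) S :
  \sum_(y in S) g #|[set z in S | (z < y)%N]| = \sum_(l < #|S|) g l.
Proof.
have [m] := ubnP #|S|; elim: m S => // m IH S.
have [-> _ | [x0 x0S]] := set_0Vmem S; first by rewrite cards0 big_set0 big_ord0.
case: (arg_maxnP (fun z : 'I_n => z : nat) x0S) => x xS0 maxx0.
have xS : x \in S by [].
have maxx (z : 'I_n) : z \in S -> (z <= x)%N by apply: maxx0.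
rewrite (big_setD1 x xS) (cardsD1 x S) xS add1n ltnS big_ord_recr /= => /IH IHx.
have eqx : [set z in S | (z < x)%N] = S :\ x.
  apply/setP => z; rewrite !inE andbC; case zS: (z \in S); rewrite ?andbF // !andbT.
  by rewrite ltn_neqAle maxx // andbT.
rewrite eqx addrC -IHx; congr (_ + _); apply: eq_bigr => y.
rewrite !inE => /andP[yx yS]; congr (g #|pred_of_set _|); apply/setP => z.
rewrite !inE; case: (eqVneq z x) => [-> | _] //=.
by rewrite xS /= ltnNge maxx.
Qed.

(** The recursion of [nc_sum_min] only sees cardinalities: if [y] has rank [l] among [k] points,
    then [k.-1 - l] points lie after it. *)
Lemma nc_sum_card f (q : nat -> R) S : (forall k, (2 < k)%N -> f k = 0) ->
  q 0%N = 1 ->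
  (forall k, q k.+1 = f 1%N * q k + f 2%N * \sum_(l < k) q l * q (k.-1 - l)%N) ->
  nc_sum f S = q #|S|.
Proof.
move=> f0 q0 qS; have [m] := ubnP #|S|; elim: m S => // m IH S.
have [-> _ | [x0 x0S]] := set_0Vmem S; first by rewrite cards0 nc_sum0.
case: (arg_minnP (fun z : 'I_n => z : nat) x0S) => x xS0 minx cS.
have xS : x \in S by [].
have minx' z : z \in S :\ x -> (x < z)%N.
  by rewrite !inE => /andP[zx zS]; rewrite ltn_neqAle minx // andbT eq_sym.
rewrite (nc_sum_min f0 xS minx') [in RHS](cardsD1 x) xS add1n qS.
move: cS; rewrite (cardsD1 x S) xS add1n ltnS => cS.
rewrite IH //; congr (_ + _ * _); rewrite -(sum_card_lt (fun l => q l * q (_ - l)%N)).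
apply: eq_bigr => y yS.
have cS2 : #|S :\ x| =
    (#|[set z in S :\ x | (z < y)%N]| + #|[set z in S :\ x | (y < z)%N]|).+1.
  rewrite (cardsD1 y (S :\ x)) yS add1n; congr _.+1; rewrite -cardsUI.
  rewrite [X in (_ + X)%N](_ : _ = 0%N) ?addn0; last first.
    apply/eqP; rewrite cards_eq0; apply/eqP/setP => z; rewrite !inE.
    by case: ltngtP; rewrite ?andbF.
  congr #|pred_of_set _|; apply/setP => z; rewrite !inE -andb_orr -neq_ltn andbC.
  by [].
have lt1 : (#|[set z in S :\ x | (z < y)%N]| < m)%N.
  by apply: leq_ltn_trans cS; rewrite cS2 ltnW // ltnS leq_addr.
have lt2 : (#|[set z in S :\ x | (y < z)%N]| < m)%N.
  by apply: leq_ltn_trans cS; rewrite cS2 ltnW // ltnS leq_addl.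
by rewrite (IH _ lt1) (IH _ lt2); congr (_ * q _); rewrite cS2 /= addKn.
Qed.

End NoncrossingSums.

(** * Free cumulants and the moment-cumulant formula *)

Section Cumulants.

Variables (C : numClosedFieldType) (mom : nat -> C).

Lemma size_kseq n : size (kseq mom n) = n.+1.
Proof. by elim: n => //= n IH; rewrite size_rcons IH. Qed.

Lemma nth_kseq n k : (k <= n)%N -> (kseq mom n)`_k = free_cumulant mom k.
Proof.
elim: n => [|n IH]; first by rewrite leqn0 => /eqP ->.
rewrite leq_eqVlt => /predU1P[-> // | lt_kn].
by rewrite /= nth_rcons size_kseq lt_kn IH.
Qed.

Lemma block_setT n (P : {set {set 'I_n}}) B :
  partition P [set: 'I_n] -> B \in P -> (n <= #|B|)%N -> P = [set [set: 'I_n]].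
Proof.
move=> partP BP le_nB.
have eB : B = [set: 'I_n].
  by apply/eqP; rewrite eqEcard subsetT cardsT card_ord.
apply/eqP; rewrite eqEsubset !sub1set -{2}eB BP andbT.
apply/subsetP => A AP; rewrite inE; apply: contraT => neA.
have /trivIsetP/(_ A B AP BP) := partition_trivIset partP.
rewrite eB neA => /(_ isT); rewrite -setI_eq0 setIT.
by rewrite (negPf (partition_neq0 partP AP)).
Qed.

(** Only the one-block partition involves order [n]; all others have smaller blocks, where the
    cumulants agree with [f]. The value [f n] is arbitrary. *)
Lemma free_cumulant_nc_sum (f : nat -> C) n : (0 < n)%N ->
  (forall k, (k < n)%N -> free_cumulant mom k = f k) ->
  free_cumulant mom n - f n = mom n - nc_sum f [set: 'I_n].
Proof.
case: n => // n _ eqf.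
have ncT : [set [set: 'I_n.+1]] \in NC n.+1.
  rewrite inE; apply/andP; split.
    rewrite /partition cover1 trivIset1 eqxx inE eq_sym; apply/set0Pn.
    by exists ord0; rewrite inE.
  by apply/noncrossingP => A B; rewrite !inE => /eqP -> /eqP ->; rewrite eqxx.
rewrite /nc_sum (bigD1 [set [set: 'I_n.+1]]) /=; last by move: ncT; rewrite inE.
rewrite big_set1 cardsT card_ord /free_cumulant /= nth_rcons size_kseq ltnn eqxx.
rewrite opprD addrA addrAC; congr (_ - _ - _).
apply: eq_big => [P | P /andP[]]; first by rewrite !inE.
rewrite inE => /andP[partP _] neP; apply: eq_bigr => B BP.
have le_Bn : (#|B| <= n)%N.
  by rewrite leqNgt; apply: contra neP => lt_nB; rewrite (block_setT partP BP lt_nB).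
by rewrite nth_kseq // eqf.
Qed.

End Cumulants.

(** * Moments of operators on the full Fock space *)

Section Fock.

Variables (R : comNzRingType) (I : eqType).

(* a + creation + b * annihilation, acting on coefficient functions of words *)
Definition fock (a b : R) (i : I) (g : seq I -> R) (v : seq I) : R :=
  a * g v + (if v is j :: v' then (j == i)%:R * g v' else 0) + b * g (i :: v).

Arguments fock : simpl never.

Definition vacuum (v : seq I) : R := (v == [::])%:R.

Definition fock_moment a b (w : seq I) : R := foldr (fock a b) vacuum w [::].


Lemma vacuum_nil : vacuum [::] = 1. Proof. by []. Qed.

Lemma vacuum_cons j v : vacuum (j :: v) = 0. Proof. by []. Qed.

Lemma fock_nil a b i g : fock a b i g [::] = a * g [::] + b * g [:: i].
Proof. by rewrite /fock addr0. Qed.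

Lemma fock_cons a b i j g v :
  fock a b i g (j :: v) = a * g (j :: v) + (j == i)%:R * g v + b * g [:: i, j & v].
Proof. by []. Qed.

Lemma foldr_nseq (T U : Type) (f : T -> U -> U) x z n :
  foldr f z (nseq n x) = iter n (f x) z.
Proof. by elim: n => //= n ->. Qed.

(** The coefficient sums the Motzkin paths of [k] steps from height 0 to [h.+1], level steps
    weighing [a] and down steps [b]. Cutting at the last step from [h] to [h.+1], with [l] steps
    before it, gives the product. *)
Lemma iter_fock_nseq a b i k h :
  iter k (fock a b i) vacuum (nseq h.+1 i) =
  \sum_(l < k) iter l (fock a b i) vacuum (nseq h i) *
               iter (k.-1 - l) (fock a b i) vacuum [::].
Proof.
elim: k h => [|k IH] h; first by rewrite big_ord0.
have eq_k (l : 'I_k) : (k - bump 0 l = k.-1 - l)%N by rewrite /bump /=; lia.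
rewrite iterS [nseq h.+1 i]/= fock_cons eqxx mul1r.
rewrite -[[:: i, i & _]]/(nseq h.+2 i) -[i :: _]/(nseq h.+1 i) !IH.
rewrite big_ord_recl subn0 [iter 0 _ _]/=.
under [in RHS]eq_bigr => l _ do rewrite eq_k.
case: h => [|h].
  rewrite vacuum_nil mul1r addrAC addrC !mulr_sumr -big_split; congr (_ + _).
  by apply: eq_bigr => l _; rewrite /= fock_nil !mulrA -mulrDl.
rewrite [nseq h.+1 i]/= vacuum_cons mul0r add0r IH !mulr_sumr -!big_split /=.
apply: eq_bigr => l _.
by rewrite /= fock_cons eqxx mul1r !mulrA -!mulrDl.
Qed.

(** This is the recursion that [nc_sum_card] asks for, with [a] and [b] as the weights of singletons
    and pairs. *)
Lemma fock_moment_nseqS a b i k :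
  fock_moment a b (nseq k.+1 i) = a * fock_moment a b (nseq k i) +
    b * \sum_(l < k) fock_moment a b (nseq l i) * fock_moment a b (nseq (k.-1 - l) i).
Proof.
rewrite /fock_moment !foldr_nseq iterS fock_nil (iter_fock_nseq _ _ _ _ 0).
by under [in RHS]eq_bigr => l _ do rewrite !foldr_nseq.
Qed.

(** A vector without components starting in [i] is a vacuum for the operator of index [i]: only the
    prefix of letters [i] changes, and [v] is carried along. *)
Lemma iter_fock_cat a b i g k l v : (forall u, g (i :: u) = 0) -> ohead v != Some i ->
  iter k (fock a b i) g (nseq l i ++ v) =
  iter k (fock a b i) vacuum (nseq l i) * g v.
Proof.
move=> g0 vi; elim: k l => [|k IH] [|l].
- by rewrite /= vacuum_nil mul1r.
- by rewrite /= g0 vacuum_cons mul0r.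
- rewrite !iterS [nseq 0 i ++ v]/= [nseq 0 i]/= fock_nil mulrDl -!mulrA.
  rewrite -[[:: i]]/(nseq 1 i) -(IH 0%N) -(IH 1%N) /fock /=.
  case: v vi {IH} => [|j v] /=; first by rewrite addr0.
  by rewrite (inj_eq Some_inj) => /negPf ->; rewrite mul0r addr0.
- rewrite !iterS [nseq l.+1 i]/= cat_cons !fock_cons eqxx !mul1r !mulrDl -!mulrA.
  by rewrite -(IH l) -(IH l.+1) -(IH l.+2).
Qed.

End Fock.

(** * Alternating products of centered powers *)

Section CenteredMoments.

Variables (R : nzRingType) (I : eqType) (m : I -> nat -> R).

(* A block [(i, k)] stands for the centered power [x_i ^ k - m i k]. *)
Fixpoint centered_moment (V : lmodType R) (F : seq I -> V) (u : seq I)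
    (bs : seq (I * nat)) : V :=
  if bs is p :: bs' then
    centered_moment F (u ++ nseq p.2 p.1) bs' - m p.1 p.2 *: centered_moment F u bs'
  else F u.

Definition word (bs : seq (I * nat)) : seq I := flatten [seq nseq p.2 p.1 | p <- bs].

(* A centered moment is the moment of its word up to moments of shorter words. *)
Lemma centered_moment_top (V : lmodType R) (F : seq I -> V) (G : seq I -> R^o) e u bs :
  (forall v, (size v < size (u ++ word bs))%N -> F v = G v *: e) ->
  all (fun p => 0 < p.2)%N bs ->
  centered_moment F u bs - F (u ++ word bs) =
  (centered_moment G u bs - G (u ++ word bs)) *: e.
Proof.
elim: bs u => [|[i k] bs IH] u /=; first by rewrite cats0 !subrr scale0r.
rewrite /word /= -/(word bs) catA => eqFG /andP[k0 bs0].
have lt_u : (size (u ++ word bs) < size ((u ++ nseq k i) ++ word bs))%N.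
  by rewrite !size_cat size_nseq; move: k0 => /=; lia.
have eq1 := IH _ eqFG bs0.
have eq2 : centered_moment F u bs = centered_moment G u bs *: e.
  apply/eqP; rewrite -subr_eq0 -(subrK (F (u ++ word bs)) (centered_moment F u bs)).
  rewrite IH //; last by move=> v lt_v; apply/eqFG/(ltn_trans lt_v).
  by rewrite eqFG // -scalerDl subrK subrr.
by rewrite addrAC eq1 eq2 scalerA -scalerBl; congr (_ *: e); rewrite addrAC.
Qed.

Lemma blocks_of_word w : exists bs, [/\ word bs = w,
  sorted (fun i j : I => i != j) (map fst bs) & all (fun p => 0 < p.2)%N bs].
Proof.
elim: w => [|i w [[|[j k] bs] [<- alt_bs bs0]]]; first by exists [::].
  by exists [:: (i, 1%N)].
have [eij | ij] := eqVneq i j; last first.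
  by exists [:: (i, 1%N), (j, k) & bs]; split; rewrite //= ij.
by subst j; exists ((i, k.+1) :: bs); split=> //; case/andP: bs0.
Qed.

(** A run as long as the whole word would make the word constant. *)
Lemma block_lt_size bs p : p \in bs -> ~~ constant (word bs) ->
  (p.2 < size (word bs))%N.
Proof.
case/splitPr=> b1 b2.
have -> : word (b1 ++ p :: b2) = word b1 ++ nseq p.2 p.1 ++ word b2.
  by rewrite /word map_cat flatten_cat.
rewrite !size_cat size_nseq; case: ltnP => // le_p; have : size (word b1) = 0%N by lia.
have : size (word b2) = 0%N by lia.
move=> /size0nil -> /size0nil ->; rewrite cats0 /= => /negP[].
exact: constant_nseq.
Qed.

Section FunctionModel.

Variables (V : lmodType R) (T : Type) (L : I -> (T -> V) -> T -> V) (g0 : T -> V).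

Hypothesis linL : forall i f g h c,
  (forall t, h t = f t - c *: g t) -> forall t, L i h t = L i f t - c *: L i g t.

(** The centered powers act as operators on functions, the last block first. The model [L] is left
    open, to cover Fock operators, scalar functionals and tensors alike. *)
Definition centered_prod (bs : seq (I * nat)) : T -> V :=
  foldr (fun p f t => iter p.2 (L p.1) f t - m p.1 p.2 *: f t) g0 bs.

Lemma foldr_centered_prod u bs t :
  foldr L (centered_prod bs) u t =
  centered_moment (fun w => foldr L g0 w t) u bs.
Proof.
have lin_foldr w f g h c : (forall t, h t = f t - c *: g t) ->
    forall t, foldr L h w t = foldr L f w t - c *: foldr L g w t.
  by elim: w => //= i w IH /IH; apply: linL.
elim: bs u => //= p bs IH u; rewrite -!IH foldr_cat foldr_nseq.
exact: lin_foldr.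
Qed.

End FunctionModel.

End CenteredMoments.

(** * Freeness of the Fock operators *)

Section FockFreeness.

Variables (R : comNzRingType) (I : eqType) (a b : R).

Lemma fock_linear (i : I) (f g h : seq I -> R) (c : R) :
  (forall v, h v = f v - c * g v) ->
  forall v, fock a b i h v = fock a b i f v - c * fock a b i g v.
Proof. by move=> hE [|j v]; rewrite /fock !hE; ring. Qed.

Lemma fock_free (bs : seq (I * nat)) : (0 < size bs)%N ->
  sorted (fun i j : I => i != j) (map fst bs) ->
  centered_moment (fun i k => fock_moment a b (nseq k i))
    (fock_moment a b : seq I -> R^o) [::] bs = 0.
Proof.
set m := fun (i : I) (k : nat) => _.
pose L : I -> (seq I -> R^o) -> seq I -> R^o := fock a b.
pose g0 : seq I -> R^o := @vacuum R I.
have -> : centered_moment m (fock_moment a b : seq I -> R^o) [::] bs =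
    centered_prod m L g0 bs [::].
  by rewrite -[RHS]/(foldr L (centered_prod m L g0 bs) [::] [::])
    foldr_centered_prod //; apply: fock_linear.
(* The induction needs more than the vacuum coefficient: all components of the vector start with the
   index of its first block. The next operator, of another index, then treats it as a vacuum, and
   centering removes what is left of it. *)
suff vanish i k bs' v : ohead v != Some i -> 
    sorted (fun i j : I => i != j) (map fst ((i, k) :: bs')) ->
    centered_prod m L g0 ((i, k) :: bs') v = 0.
  by case: bs => // [[i k] bs'] _ /vanish; apply.
elim: bs' i k v => [|[j l] bs' IH] i k v vi.
  move=> _; rewrite /= -[v]/(nseq 0 i ++ v) iter_fock_cat //=.
  by rewrite /m /fock_moment foldr_nseq subrr.
move=> /= /andP[ij alt]; rewrite -/(centered_prod m L g0 ((j, l) :: bs')).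
set g := (fun t => _ : R^o).
have gi u : g (i :: u) = 0.
  by apply: (IH j l) => //=; rewrite (inj_eq Some_inj).
rewrite -[v]/(nseq 0 i ++ v) (iter_fock_cat _ _ _ _ gi) //=.
by rewrite /m /fock_moment foldr_nseq subrr.
Qed.

End FockFreeness.

(** * Quantum orthogonal transformation of functions on words *)

Section WordTransform.

Variables (R : comNzRingType) (B : algType R) (d : nat).
Implicit Types (t : 'I_d -> 'I_d -> B) (g h k : seq 'I_d -> R) (w v : seq 'I_d).

(* [\sum_(v : size v = size w) g v *: (t v_1 w_1 * ... * t v_n w_n)] *)
Fixpoint transform t g w : B :=
  if w is j :: w' then \sum_i t i j * transform t (fun v => g (i :: v)) w'
  else (g [::])%:A.

Lemma transform_lin t g h k c e w : (forall v, k v = c * g v + e * h v) ->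
  transform t k w = c *: transform t g w + e *: transform t h w.
Proof.
elim: w g h k => [|j w IH] g h k kE /=; first by rewrite kE scalerDl !scalerA.
rewrite !scaler_sumr -big_split; apply: eq_bigr => i _ /=.
rewrite (IH (fun v => g (i :: v)) (fun v => h (i :: v))) => [|v]; last exact: kE.
by rewrite mulrDr !scalerAr.
Qed.

Lemma eq_transform t g h w : (forall v, size v = size w -> g v = h v) ->
  transform t g w = transform t h w.
Proof.
elim: w g h => [|j w IH] g h gh /=; first by rewrite gh.
by apply: eq_bigr => i _; congr (_ * _); apply: IH => v sv; apply: gh; rewrite /= sv.
Qed.

Lemma transform0 t g w : (forall v, g v = 0) -> transform t g w = 0.
Proof.
move=> g0; rewrite (transform_lin t (g := g) (h := g) (c := 0) (e := 0)).
  by rewrite !scale0r addr0.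
by move=> v; rewrite g0 !mul0r addr0.
Qed.

(** Each [i] contributes its one constant word. The empty word is excluded: there the left side is 1
    and the right side is [d]. *)
Lemma transform_constant t w : (0 < size w)%N ->
  transform t (fun v => (constant v)%:R) w = \sum_i \prod_(j <- w) t i j.
Proof.
case: w => // j w _ /=; apply: eq_bigr => i _; rewrite big_cons; congr (_ * _).
elim: w {j} => [|j w IH] /=; first by rewrite big_nil scale1r.
rewrite big_cons (bigD1 i) //= big1 ?addr0 => [|l li].
  by rewrite -IH; congr (_ * _); apply: eq_transform => v _; rewrite eqxx.
by rewrite transform0 ?mulr0 // => v; rewrite (negPf li).
Qed.

Section Orthogonal.

Variables (u : 'I_d -> 'I_d -> B) (b : R).
Hypothesis orth_u : forall i j, \sum_k u k i * u k j = (i == j)%:R.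

Let ut i j := u j i.

Lemma orth_contract (K : 'I_d -> B) j :
  \sum_i u i j * (\sum_l u i l * K l) = K j.
Proof.
under eq_bigr => i _ do rewrite mulr_sumr.
rewrite exchange_big /= (bigD1 j) //= [X in _ + X]big1 ?addr0 => [|l lj].
  by under eq_bigr => i _ do rewrite mulrA; rewrite -mulr_suml orth_u eqxx mul1r.
under eq_bigr => i _ do rewrite mulrA.
by rewrite -mulr_suml orth_u eq_sym (negPf lj) mul0r.
Qed.

(* Quantum orthogonal invariance: the transform by the transpose intertwines
   the operator [\sum_i u i j * fock i] with [fock j]. *)
Lemma transform_fock g j v :
  \sum_i u i j * ((if v is i' :: v' then (i' == i)%:R * transform ut g v' else 0) +
                   b *: transform ut g (i :: v)) =
  transform ut (fock 0 b j g) v.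
Proof.
under eq_bigr => i _ do rewrite mulrDr -scalerAr.
rewrite big_split /= -scaler_sumr.
rewrite (orth_contract (fun l => transform ut (fun x => g (l :: x)) v)).
case: v => [|i v] /=.
  rewrite big1 ?add0r => [|i _]; last by rewrite mulr0.
  by rewrite fock_nil mul0r add0r scalerA.
rewrite (bigD1 i) //= eqxx mul1r [X in _ + X + _]big1 ?addr0 => [|l li]; last first.
  by rewrite eq_sym (negPf li) mul0r mulr0.
have fE l : transform ut (fun x => fock 0 b j g (l :: x)) v =
    (l == j)%:R *: transform ut g v + b *: transform ut (fun x => g [:: j, l & x]) v.
  by apply: transform_lin => x; rewrite fock_cons mul0r add0r.
under [in RHS]eq_bigr => l _ do rewrite fE mulrDr -!scalerAr.
rewrite big_split /= -scaler_sumr; congr (_ + _).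
rewrite (bigD1 j) //= eqxx scale1r [X in _ + X]big1 ?addr0 // => l lj.
by rewrite (negPf lj) scale0r.
Qed.

Lemma transform_fock_moment w :
  transform u (fock_moment 0 b) w = (fock_moment 0 b w)%:A.
Proof.
(* The claim is extended to all coefficients [v], since the Fock operators mix them; at the empty
   [v] the right side is the scalar moment. *)
suff H v : transform u (fun x => foldr (fock 0 b) (@vacuum R _) x v) w =
           transform ut (foldr (fock 0 b) (@vacuum R _) w) v by rewrite [LHS]H.
elim: w v => [|j w IH] v.
  case: v => [|i v] //=; rewrite vacuum_cons scale0r big1 // => l _.
  by rewrite transform0 ?mulr0.
rewrite /= -transform_fock; apply: eq_bigr => i _; congr (_ * _).
case: v => [|i' v]; rewrite -!IH.
  rewrite add0r (transform_lin _ (g := fun x => foldr (fock 0 b) (@vacuum R _) x [:: i])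
    (h := fun=> 0) (c := b) (e := 0)) ?scale0r ?addr0 // => x.
  by rewrite fock_nil; ring.
rewrite mulr_natl -scaler_nat; apply: transform_lin => x.
by rewrite fock_cons mul0r add0r.
Qed.

End Orthogonal.

End WordTransform.

(** * Effect of centering on the moments of one variable *)

Section Shift.

Variables (R : comNzRingType) (a k0 : R) (n : nat) (D : nat -> nat -> R).
Hypothesis D_rec : forall k l, D k.+1 l = D k l.+1 - a * D k l.
Hypothesis D_lt : forall l, (l < n)%N -> D 0%N l = 0.
Hypothesis D_n : D 0%N n = k0.

Lemma shift_lt k l : (k + l < n)%N -> D k l = 0.
Proof.
elim: k l => [|k IH] l lt_n; first exact: D_lt.
by rewrite D_rec !IH ?mulr0 ?subr0 //; lia.
Qed.

(** Along the diagonal [k + l = n] the correction [a * D k l] has lower order and vanishes, so the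
    value does not change. *)
Lemma shift_eq k l : (k + l = n)%N -> D k l = k0.
Proof.
elim: k l => [|k IH] l eq_n; first by rewrite -D_n; congr D.
by rewrite D_rec IH ?shift_lt ?mulr0 ?subr0 //; lia.
Qed.

End Shift.

(** * Formal tensors as operators on functions *)

Section TensorAction.

Variables (C : numClosedFieldType) (A B : algType C).
Implicit Types (l : seq (A * B)) (g h : A -> B).

(* [x |-> E((x (x) 1) l t)], given [g x = E((x (x) 1) t)]: formal sums of
   elementary tensors act on such functions, which linearizes [tmul]. *)
Definition tact l g (x : A) : B := \sum_(p <- l) p.2 * g (x * p.1).

Lemma eq_tact l g h : g =1 h -> tact l g =1 tact l h.
Proof. by move=> gh x; apply: eq_bigr => p _; rewrite gh. Qed.

Lemma tact_linear l f g h (c : C) : (forall x, h x = f x - c *: g x) ->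
  forall x, tact l h x = tact l f x - c *: tact l g x.
Proof.
move=> hE x; rewrite /tact scaler_sumr -sumrB; apply: eq_bigr => p _.
by rewrite hE mulrBr scalerAr.
Qed.

Lemma tact_cat l l' g x : tact (l ++ l') g x = tact l g x + tact l' g x.
Proof. exact: big_cat. Qed.

Lemma tact1 g b x : tact [:: (1, b)] g x = b * g x.
Proof. by rewrite /tact big_seq1 mulr1. Qed.

Lemma tact_tmul l l' g : tact (tmul l l') g =1 tact l (tact l' g).
Proof.
move=> x; rewrite /tact big_allpairs_dep; apply: eq_bigr => p _.
by rewrite mulr_sumr; apply: eq_bigr => q _; rewrite /= !mulrA.
Qed.

Lemma tact_foldr ls g : tact (foldr (@tmul C A B) [:: (1, 1)] ls) g =1 foldr tact g ls.
Proof.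
elim: ls => [|l ls IH] x /=; first by rewrite tact1 mul1r.
by rewrite tact_tmul; apply: eq_tact.
Qed.

Lemma tE_tact phi l : tE phi l = tact l (fun x => (phi x)%:A) 1.
Proof. by apply: eq_bigr => p _; rewrite mul1r mulr_algr. Qed.

End TensorAction.

(** * Scalar freeness against freeness with amalgamation *)

Section FreeTransform.

Variables (C : numClosedFieldType) (A B : algType C) (phi : A -> C).
Variables (d : nat) (X : 'I_d -> A) (ud : 'I_d -> 'I_d -> B).
Variables (a b kap : C) (n : nat).

Hypothesis phi_lin : forall c x y, phi (c *: x + y) = c * phi x + phi y.
Hypothesis phi1 : phi 1 = 1.
Hypothesis orth_ud : forall i j, \sum_(k < d) ud k i * ud k j = (i == j)%:R.
Hypothesis freeX : free_family phi X.
Hypothesis freeY : amalg_free phi (Ytens X ud).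
Hypothesis mom_lt : forall i k, (k < n)%N ->
  phi (X i ^+ k) = fock_moment a b (nseq k i).
Hypothesis mom_n : forall i, phi (X i ^+ n) = fock_moment a b (nseq n i) + kap.

Let phiB x c y : phi (x - c *: y) = phi x - c * phi y.
Proof. by rewrite -scaleNr addrC phi_lin mulNr addrC. Qed.

Let X' i := X i - a%:A.
Let mom (i : 'I_d) k : C := fock_moment 0 b (nseq k i).

(** Mixed powers lead from [X] at [k = 0] to [X'] at [l = 0], one factor at a time; in parallel,
    [fock a b] minus [a] is [fock 0 b]. *)
Let D i k l : C := phi (X' i ^+ k * X i ^+ l) -
  iter k (fock 0 b i) (iter l (fock a b i) (@vacuum C _)) [::].

Let D_rec i k l : D i k.+1 l = D i k l.+1 - a * D i k l.
Proof.
rewrite /D; have -> : X' i ^+ k.+1 * X i ^+ l =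
    X' i ^+ k * X i ^+ l.+1 - a *: (X' i ^+ k * X i ^+ l).
  by rewrite exprSr -mulrA mulrBl mulr_algl -exprS mulrBr -scalerAr.
rewrite phiB iterSr [iter l.+1 _ _]/=; set g := iter l _ _.
have iter_lin (f1 f2 f3 : seq 'I_d -> C) c : (forall v, f3 v = f1 v - c * f2 v) ->
    forall v, iter k (fock 0 b i) f3 v =
      iter k (fock 0 b i) f1 v - c * iter k (fock 0 b i) f2 v.
  by elim: k => //= m IH /IH; apply: fock_linear.
rewrite (iter_lin (fock a b i g) g _ a) => [|v]; first by ring.
by rewrite /fock mul0r add0r; ring.
Qed.

Lemma shifted_mom_lt i k : (k < n)%N -> phi (X' i ^+ k) = mom i k.
Proof.
move=> lt_kn; apply/eqP; rewrite -subr_eq0 -[X' i ^+ k]mulr1 -[1](expr0 (X i)).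
rewrite /mom /fock_moment foldr_nseq -[X in X == _]/(D i k 0).
rewrite (shift_lt (D_rec i) (n := n)) ?addn0 // => l lt_ln.
by rewrite /D expr0 mul1r mom_lt // /fock_moment foldr_nseq subrr.
Qed.

Lemma shifted_mom_n i : phi (X' i ^+ n) = mom i n + kap.
Proof.
apply/eqP; rewrite addrC -subr_eq -[X' i ^+ n]mulr1 -[1](expr0 (X i)).
rewrite /mom /fock_moment foldr_nseq -[X in X == _]/(D i n 0); apply/eqP.
apply: (@shift_eq _ a kap n (D i) (D_rec i)) => [l lt_ln||]; last by rewrite addn0.
  by rewrite /D expr0 mul1r mom_lt // /fock_moment foldr_nseq subrr.
by rewrite /D expr0 mul1r mom_n /fock_moment foldr_nseq addrC addKr.
Qed.

Let prodX w : A := \prod_(i <- w) X' i.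

Let prodX_nseq k i : prodX (nseq k i) = X' i ^+ k.
Proof.
by rewrite /prodX; elim: k => [|k IHk]; rewrite /= ?big_nil ?big_cons ?IHk ?exprS.
Qed.

(** On functionals [x |-> phi (x * y)] this replaces [y] by [X' i * y], so that words in the [X']
    become iterated operators. *)
Let L1 (i : 'I_d) (g : A -> C^o) (x : A) : C^o := g (x * X' i).

Let centered_momX bs :
  centered_moment mom (fun w => phi (prodX w) : C^o) [::] bs =
  phi (\prod_(p <- bs) (X' p.1 ^+ p.2 - (mom p.1 p.2)%:A)).
Proof.
have foldrE (g : A -> C^o) w x : foldr L1 g w x = g (x * prodX w).
  rewrite /prodX; elim: w x => [|i w IH] x /=; first by rewrite big_nil mulr1.
  by rewrite /L1 IH big_cons mulrA.
have -> : centered_moment mom (fun w => phi (prodX w) : C^o) [::] bs =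
    centered_moment mom (fun w => foldr L1 (phi : A -> C^o) w 1) [::] bs.
  elim: bs [::] => /= [w | p bs IH w]; first by rewrite foldrE mul1r.
  by rewrite !IH.
rewrite -foldr_centered_prod /=; last by move=> i f g h c hE x; apply: hE.
suff cpE x : centered_prod mom L1 phi bs x =
    phi (x * \prod_(p <- bs) (X' p.1 ^+ p.2 - (mom p.1 p.2)%:A)).
  by rewrite cpE mul1r.
elim: bs x => [|p bs IH] x /=; first by rewrite big_nil mulr1.
rewrite big_cons mulrA mulrBr mulr_algr mulrBl -scalerAl phiB -!IH; congr (_ - _).
rewrite -foldr_nseq foldrE; congr (centered_prod _ _ _ _ (x * _)).
exact: prodX_nseq.
Qed.

Let free_momX bs : (0 < size bs)%N -> sorted (fun i j : 'I_d => i != j) (map fst bs) ->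
  (forall p, p \in bs -> p.2 < n)%N ->
  centered_moment mom (fun w => phi (prodX w) : C^o) [::] bs = 0.
Proof.
move=> bs0 alt lt_n; rewrite centered_momX.
pose s := [seq (p.1, X' p.1 ^+ p.2 - (mom p.1 p.2)%:A) | p <- bs].
have := freeX (s := s); rewrite size_map big_map /=; apply=> //.
  by rewrite -map_comp.
move=> _ /mapP[p pbs ->] /=; split; last first.
  by rewrite phiB phi1 mulr1 shifted_mom_lt ?subrr // lt_n.
move=> S S1 SX SD SM SZ.
have SB y c : S y -> S (y - c%:A).
  by move=> Sy; rewrite -scaleNr; apply: SD => //; apply: SZ.
apply: (SB); elim: p.2 => [|k IH] //; rewrite exprS; apply: (SM) => //.
exact/SB/SX.
Qed.

(** Induction on the length: with [w] cut into runs, the centered product vanishes under [phi] and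
    in the Fock model, so agreement on shorter words passes to [w]. The condition keeps every run
    shorter than [n]. *)
Lemma prodX_moment w : (size w < n)%N || (size w == n) && ~~ constant w ->
  phi (prodX w) = fock_moment 0 b w.
Proof.
have [m] := ubnP (size w); elim: m w => // m IH w; rewrite ltnS => le_wm hw.
have [bs [wE alt bs_gt0]] := blocks_of_word w.
case: bs => [|p bs] in wE alt bs_gt0 *.
  by rewrite -wE /prodX big_nil phi1.
have le_wn : (size w <= n)%N by case/orP: hw => [/ltnW | /andP[/eqP -> _]].
have lt_bs q : q \in p :: bs -> (q.2 < n)%N.
  move=> qbs; case/orP: hw => [lt_wn | /andP[/eqP <- nw]].
    apply: leq_ltn_trans lt_wn; rewrite -wE; case/splitPr: qbs => b1 b2.
    by rewrite /word map_cat flatten_cat /= !size_cat size_nseq; lia.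
  by rewrite -wE; apply: block_lt_size => //; rewrite wE.
have := @centered_moment_top _ _ mom _ (fun w => phi (prodX w) : C^o)
  (fock_moment 0 b : seq _ -> C^o) 1 [::] (p :: bs).
rewrite free_momX // fock_free // !sub0r cat0s wE => /(_ _ bs_gt0) top.
have {top} : - phi (prodX w) = - fock_moment 0 b w.
  rewrite -[RHS]mulr1; apply: top => v lt_vw.
  rewrite IH; [by rewrite /GRing.scale /= mulr1 | exact: leq_trans le_wm |].
  by rewrite (leq_trans lt_vw).
by move/oppr_inj.
Qed.

(** This represents the sum of the [X' i (x) ud i j]; the correction lies in [B], so the algebra
    generated over [B] contains it. *)
Let Y' j : seq (A * B) := Ytens X ud j ++ [:: (1, - (a *: \sum_i ud i j))].
Let G0 (x : A) : B := (phi x)%:A.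
Let L3 j : (A -> B) -> A -> B := tact (Y' j).

Let foldr_L3 w x :
  foldr L3 G0 w x = transform ud (fun v => phi (x * prodX v)) w.
Proof.
elim: w x => [|j w IH] x /=; first by rewrite /G0 /prodX big_nil mulr1.
rewrite /L3 -/L3 /Y' tact_cat tact1 /tact /Ytens big_map big_enum /=.
rewrite mulNr -scalerAl mulr_suml scaler_sumr -sumrB; apply: eq_bigr => i _.
rewrite !IH scalerAr -mulrBr; congr (_ * _).
rewrite (transform_lin ud (k := fun v => phi (x * prodX (i :: v)))
  (g := fun v => phi (x * X i * prodX v))
  (h := fun v => phi (x * prodX v)) (c := 1) (e := - a)).
  by rewrite scale1r scaleNr.
move=> v; rewrite mul1r mulNr -phiB /prodX big_cons /X' mulrBl mulr_algl mulrBr.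
by rewrite mulrA -scalerAr.
Qed.

Let momY w : foldr L3 G0 w 1 = transform ud (fun v => phi (prodX v)) w.
Proof. by rewrite foldr_L3; apply: eq_transform => v _; rewrite mul1r. Qed.

(** The transform fixes Fock moments, so these [B]-valued moments are scalars; hence subtracting
    [mom] centers the powers in [block_tensor]. *)
Let momY_lt w : (size w < n)%N -> foldr L3 G0 w 1 = (fock_moment 0 b w)%:A.
Proof.
move=> lt_wn; rewrite momY -(transform_fock_moment b orth_ud).
by apply: eq_transform => v sv; rewrite prodX_moment // sv lt_wn.
Qed.

(** At order [n] the scalar moments exceed the Fock moments by [kap] on constant words only, and
    [transform_constant] evaluates this excess. *)
Let momY_eq w : (0 < n)%N -> size w = n -> foldr L3 G0 w 1 =
  (fock_moment 0 b w)%:A + kap *: \sum_i \prod_(j <- w) ud i j.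
Proof.
move=> n0 sw; rewrite momY -(transform_fock_moment b orth_ud).
rewrite -transform_constant ?sw // -[X in X + _]scale1r.
rewrite -(transform_lin ud
  (k := fun v => 1 * fock_moment 0 b v + kap * (constant v)%:R)) //.
apply: eq_transform => v; rewrite sw mul1r => sv.
have [const_v | nconst_v] := boolP (constant v); last first.
  by rewrite mulr0 addr0 prodX_moment // sv eqxx nconst_v orbT.
case: v sv const_v => [|i0 v] sv; first by rewrite -sv in n0.
case/(constantP i0) => i ->; rewrite mulr1 sv -shifted_mom_n; congr phi.
exact: prodX_nseq.
Qed.

Let block_tensor (p : 'I_d * nat) : seq (A * B) :=
  foldr (@tmul C A B) [:: (1, 1)] (nseq p.2 (Y' p.1)) ++ [:: (1, - (mom p.1 p.2)%:A)].

Let tact_block p g x :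
  tact (block_tensor p) g x = iter p.2 (L3 p.1) g x - mom p.1 p.2 *: g x.
Proof.
by rewrite tact_cat tact1 tact_foldr foldr_nseq mulNr mulr_algl.
Qed.

Let block_tensor_gen p : in_gen_Balg (Ytens X ud p.1) (block_tensor p).
Proof.
move=> S SB SY Scat Smul _; apply: (Scat) => //.
elim: p.2 => [|k IH] /=; first exact: SB.
by apply: (Smul) => //; apply: (Scat) => //; apply: SB.
Qed.

Let tE_block p : (p.2 < n)%N -> tE phi (block_tensor p) = 0.
Proof.
move=> lt_pn; rewrite tE_tact tact_block -foldr_nseq momY_lt ?size_nseq //.
by rewrite phi1 /mom scale1r subrr.
Qed.

Let free_momY bs : (0 < size bs)%N -> sorted (fun i j : 'I_d => i != j) (map fst bs) ->
  (forall p, p \in bs -> p.2 < n)%N ->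
  centered_moment mom (fun w => foldr L3 G0 w 1) [::] bs = 0.
Proof.
move=> bs0 alt lt_n; rewrite -foldr_centered_prod /=; last first.
  by move=> j; apply: tact_linear.
have := freeY (s := [seq (p.1, block_tensor p) | p <- bs]).
rewrite size_map -!map_comp => /(_ bs0 alt) => free0.
rewrite -[RHS]free0; last first.
  move=> _ /mapP[p pbs ->]; split; first exact: block_tensor_gen.
  by apply: tE_block; apply: lt_n.
rewrite tE_tact tact_foldr; elim: bs {bs0 alt lt_n free0} (1 : A) => //= p bs IH x.
rewrite tact_block; congr (_ - _ *: _); last exact: IH.
elim: p.2 x => //= k IHk x; exact: eq_tact.
Qed.

(** Amalgamated freeness determines the moment of [w] from shorter ones as in the Fock model,
    leaving no room for the excess in [momY_eq]. *)
Lemma cumulant_scale_eq0 w : (1 < n)%N -> size w = n -> ~~ constant w ->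
  kap *: \sum_i \prod_(j <- w) ud i j = 0.
Proof.
move=> n1 sw nconst_w; have n0 := ltnW n1.
have [bs [wE alt bs_gt0]] := blocks_of_word w.
have bs0 : (0 < size bs)%N by case: bs wE {alt bs_gt0} => //= wE; rewrite -wE in nconst_w.
have lt_bs p : p \in bs -> (p.2 < n)%N.
  by move=> pbs; rewrite -sw -wE block_lt_size // wE.
have := @centered_moment_top _ _ mom _ (fun w => foldr L3 G0 w 1)
  (fock_moment 0 b : seq _ -> C^o) 1 [::] bs.
rewrite free_momY // fock_free // !sub0r cat0s wE => /(_ _ bs_gt0) top.
have {top} top : - foldr L3 G0 w 1 = (- fock_moment 0 b w)%:A.
  by apply: top => v lt_vw; rewrite momY_lt // -sw.
have FE : foldr L3 G0 w 1 = (fock_moment 0 b w)%:A.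
  by apply: oppr_inj; rewrite top scaleNr.
by apply: (addrI (fock_moment 0 b w)%:A); rewrite addr0 -[RHS]FE momY_eq.
Qed.

End FreeTransform.

(** * From vanishing power sums to the relations of [H_d^+] *)

Section RowContraction.

Variables (R : comNzRingType) (B : algType R) (d : nat) (u : 'I_d -> 'I_d -> B).
Hypothesis orth_rows : forall i j, \sum_(k < d) u i k * u j k = (i == j)%:R.

Lemma row_products_eq0 n k j j' : (2 < n)%N -> j != j' ->
  (forall w, size w = n -> ~~ constant w -> \sum_i \prod_(l <- w) u i l = 0) ->
  u k j * u k j' = 0.
Proof.
case: n => [|[|[|n]]] // _ jj' sum0.
(* Here [n] is the original order minus 3: two letters are [j] and [j'], and one is the first letter
   [l], contracted against [u k l] to replace the sum over rows by row [k]. *)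
have prod0 v : size v = n -> u k j * u k j' * \prod_(l <- v) u k l = 0.
  move=> sv; pose w := [:: j, j' & v].
  have -> : u k j * u k j' * \prod_(l <- v) u k l = \prod_(l <- w) u k l.
    by rewrite !big_cons mulrA.
  rewrite -(orth_contract (u := fun l i => u i l) orth_rows
    (fun i => \prod_(l <- w) u i l)).
  rewrite big1 // => l _.
  have -> : \sum_i u i l * \prod_(m <- w) u i m = \sum_i \prod_(m <- l :: w) u i m.
    by apply: eq_bigr => i _; rewrite [RHS]big_cons.
  rewrite sum0 ?mulr0 //= ?sv //.
  by apply: contra jj' => /and3P[/eqP -> /eqP ->].
elim: n prod0 {sum0} => [|n IH] prod0.
  by have := prod0 [::] erefl; rewrite big_nil mulr1.
have sum1 : \sum_l u k l * u k l = 1 by rewrite orth_rows eqxx.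
(* Each term of the inserted row sum contains the product for [rcons v l], one letter longer, which
   is already 0. *)
apply: IH => v sv; rewrite -[LHS]mulr1 -[X in _ * X]sum1 mulr_sumr big1 // => l _.
have := prod0 (rcons v l); rewrite size_rcons sv => /(_ erefl).
by rewrite big_rcons /= !mulrA => ->; rewrite mul0r.
Qed.

Lemma row_square_idem k j :
  (forall j', j != j' -> u k j * u k j' = 0) -> u k j ^+ 2 = u k j ^+ 4.
Proof.
move=> ortho; have sum1 : \sum_l u k l * u k l = 1 by rewrite orth_rows eqxx.
rewrite -[LHS]mulr1 -[X in _ * X]sum1 mulr_sumr (bigD1 j) //= big1 ?addr0 => [|l lj].
  by rewrite -expr2 -exprD.
by rewrite expr2 -mulrA (mulrA (u k j) (u k l)) ortho 1?eq_sym // mul0r mulr0.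
Qed.

End RowContraction.

(** * Induction on the order of the first nonvanishing higher cumulant *)

Theorem mainTheorem1 (C : numClosedFieldType) (d : nat)
  (B : algType C) (sB : B -> B) (ud : 'I_d -> 'I_d -> B)
  (A : algType C) (sA : A -> A) (phi : A -> C) (X : 'I_d -> A) :
  (2 <= d)%N ->
  (* B = Pol(X) is a *-algebra with a faithful *-representation *)
  is_star sB -> has_faithful_star_rep sB ->
  (* beta : Pol(O_d^+) -> B surjective unital *-hom, ud i j = beta(u_ij) *)
  OdPlus_rel sB ud ->
  (forall b : B, in_gen_alg (fun y => exists i j, y = ud i j) b) ->
  (* (A, phi) non-commutative probability space *)
  is_star sA -> is_state sA phi ->
  (* X_i self-adjoint, free, identically distributed *)
  (forall i, sA (X i) = X i) ->
  free_family phi X ->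
  (forall i j (m : nat), phi (X i ^+ m) = phi (X j ^+ m)) ->
  (* Y_j free with amalgamation over B *)
  amalg_free phi (Ytens X ud) ->
  (forall i j, ud i j ^+ 2 = ud i j ^+ 4) \/
  (forall i (n : nat), (3 <= n)%N ->
     free_cumulant (fun m => phi (X i ^+ m)) n = 0).
Proof.
move=> _ _ _ [_ [orth_cols orth_rows]] _ _ [phi_lin [phi1 _]] _ freeX idX freeY.
have [/forallP idem | not_idem] := boolP [forall i, forall j, ud i j ^+ 2 == ud i j ^+ 4].
  by left => i j; have /forallP/(_ j)/eqP := idem i.
right=> i n; set mom := fun m => _; set kap := free_cumulant mom.
(* These are the semicircular cumulants with the given mean and variance; order 0 gets the default 0
   of [kseq]. *)
pose f k := if k is k'.+1 then if k' is k''.+1 then if k'' is _.+1 then 0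
  else kap 2%N else kap 1%N else 0.
have kap_f : (forall k, kap k = f k) -> (2 < n)%N -> kap n = 0.
  by move=> ->; case: n => [|[|[|n]]].
apply: kap_f => k; have [m] := ubnP k; elim: m k => // m IH k; rewrite ltnS => le_km.
have [|k_gt2] := leqP k 2; first by case: k le_km => [|[|[|k]]].
have kap_lt l : (l < k)%N -> kap l = f l.
  by move=> lt_lk; apply: IH; apply: leq_trans le_km.
have f_gt2 l : (2 < l)%N -> f l = 0 by case: l => [|[|[|l]]].
have nc_fock (j : 'I_d) l : nc_sum f [set: 'I_l] = fock_moment (f 1%N) (f 2%N) (nseq l j).
  rewrite (nc_sum_card (q := fun l => fock_moment (f 1%N) (f 2%N) (nseq l j))) //.
    by rewrite cardsT card_ord.
  exact: fock_moment_nseqS.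
(* The correction is 0 for [l < k] and equals [kap k] for [l = k], as [f k = 0]. *)
have mom_fock j l : (0 < l)%N -> (l <= k)%N -> phi (X j ^+ l) =
    fock_moment (f 1%N) (f 2%N) (nseq l j) + (kap l - f l).
  move=> l_gt0 le_lk; rewrite (idX j i) -(nc_fock j) free_cumulant_nc_sum ?subrKC //.
  by move=> l' lt_l'; apply: kap_lt; apply: leq_trans le_lk.
(* A nonzero [kap k] can be cancelled from [cumulant_scale_eq0], which leaves the vanishing sums
   needed for the row contraction. *)
apply/eqP; rewrite f_gt2 //; apply: contraNT not_idem => kap_neq0.
apply/forallP => r; apply/forallP => j; apply/eqP/row_square_idem => // j' jj'.
apply: (row_products_eq0 orth_rows (n := k)) => // w sw nconst_w; apply/eqP.
have : kap k *: (\sum_i0 \prod_(l <- w) ud i0 l) == 0; last first.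
  by rewrite scaler_eq0 (negPf kap_neq0).
apply/eqP; apply: (cumulant_scale_eq0 (a := f 1%N) (b := f 2%N) (n := k)
  phi_lin phi1 orth_cols freeX freeY) => //.
- move=> j0 [_ | l lt_lk]; first by rewrite expr0 phi1.
  by rewrite mom_fock ?kap_lt ?subrr ?addr0 // ltnW.
- by move=> j0; rewrite mom_fock ?(f_gt2 k) ?subr0 //; lia.
- lia.
Qed.
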